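(* There is an LCL problem on general (undirected, bounded-degree) graphs, with no promise on the structure of the input graph, whose existential mending volume is $\exists\mathsf{MVol}=O(\log n)$ and whose expected mending volume is $\mathsf{EMVol}=\omega(\log n)$.
   Context: All graphs have maximum degree bounded by a constant. An LCL problem $\Pi=(\Sigma,\mathcal G,\phi)$ consists of a finite label set $\Sigma$, a class $\mathcal G$ of input graphs, and a local verifier $\phi$ of constant radius $r$: $\phi(G,\lambda,v)\in\{\text{happy},\text{unhappy}\}$ depends only on the isomorphism type of the labeled radius-$r$ neighborhood of $v$. A partial solution is a labeling $\lambda:V(G)\to\Sigma\sqcup\{\bot\}$ such that every vertex with no $\bot$ within distance $r$ is happy. A hole is a vertex labeled $\bot$. A mend of $\lambda$ at a hole $v$ is a partial solution $\lambda'$ with $\lambda'(v)\neq\bot$ and $\lambda'(u)\neq\bot$ whenever $\lambda(u)\ne\bot$. Mends are assumed to always exist. $\exists\mathsf{MVol}$ (existential mending volume), on $n$-vertex instances: $\max_{G,\lambda,v}\min\{|\{u:\lambda(u)\neq\lambda'(u)\}|:\lambda'\text{ mend of }\lambda\text{ at }v\}$. A set $W\subseteq V(G)$ contains a mend of $\lambda$ at $v$ if some mend $\lambda'$ of $\lambda$ at $v$ satisfies $\{u:\lambda'(u)\ne\lambda(u)\}\subseteq W$. A (local) mender $\mathcal M$ assigns to each $(G,\lambda,v)$ a Markov chain $\mathcal M_{G,\lambda,v}$ on subsets of $V(G)$ such that: (progress) $\mathcal M_{G,\lambda,v}(W,W')>0$ implies $W\subseteq W'$; (termination) $\mathcal M_{G,\lambda,v}(W,W)=1$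 iff $W$ contains a mend of $\lambda$ at $v$; (locality) $\mathcal M_{G,\lambda,v}(W,\cdot)$ depends only on $W$ and its direct neighborhood. In the exploration model, at each step the mender explores neighbors of the already explored set, and it learns only the explored set $W$ and the list of neighbors of its vertices. The chain is absorbing; $\mathcal M^*_{G,\lambda,v}(\{v\},\cdot)$ is its limiting distribution started at $\{v\}$. Then $\mathsf{EMVol}(\mathcal M,G)=\max_{\lambda,v}\sum_{W_F}\mathcal M^*_{G,\lambda,v}(\{v\},W_F)|W_F|$, the sum being over absorbing states $W_F$. $\Pi$ has $\mathsf{EMVol}=\omega(T)$ if for every mender $\mathcal M$ there are instances $G_n\in\mathcal G$ of size $n$ with $\mathsf{EMVol}(\mathcal M,G_n)=\omega(T(n))$. *)

(* Defs.v *)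
From HB Require Import structures.
From mathcomp Require Import all_boot all_order all_algebra.
From mathcomp Require Import all_classical all_reals all_analysis.
Set Implicit Arguments.
Unset Strict Implicit.
Unset Printing Implicit Defensive.
Import Order.TTheory GRing.Theory Num.Theory.
Import numFieldNormedType.Exports.
Local Open Scope ring_scope.

(* A finite simple graph on the vertex set 'I_n is given by its neighbourhood
   function; [G u] is the set of neighbours of [u]. *)
Definition simple_nbh n (e : {ffun 'I_n -> {set 'I_n}}) : bool :=
  [forall u, (u \notin e u) && [forall w, (w \in e u) == (u \in e w)]].

Record sgraph n :=
  SGraph { nbh :> {ffun 'I_n -> {set 'I_n}}; _ : simple_nbh nbh }.

HB.instance Definition _ n := [isSub for @nbh n].
HB.instance Definition _ n := [Finite of sgraph n by <:].

Definition max_degree_le (D n : nat) (G : sgraph n) : bool :=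
  [forall u, (#|G u| <= D)%N].

Definition closed_nbh n (G : sgraph n) (W : {set 'I_n}) : {set 'I_n} :=
  W :|: \bigcup_(u in W) G u.

(* Vertices at distance at most [r] from [v]. *)
Definition gball n (G : sgraph n) (r : nat) (v : 'I_n) : {set 'I_n} :=
  iter r (closed_nbh G) [set v].

(* [None] is the label of a hole. *)
Definition labeling (Sigma : finType) n := {ffun 'I_n -> option Sigma}.

(* The radius-r neighbourhoods (labelled induced subgraphs, rooted at the
   centre) of [v] and [v'] are isomorphic. *)
Definition same_gball (Sigma : finType) (r : nat)
    n (G : sgraph n) (lam : labeling Sigma n) (v : 'I_n)
    m (G' : sgraph m) (lam' : labeling Sigma m) (v' : 'I_m) : Prop :=
  exists f : 'I_n -> 'I_m,
    [/\ f v = v',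
        {in gball G r v &, injective f},
        f @: gball G r v = gball G' r v',
        {in gball G r v &, forall x y, (f y \in G' (f x)) = (y \in G x)} &
        {in gball G r v, forall x, lam' (f x) = lam x}].

Record lcl := Lcl {
  lcl_label : finType;
  lcl_class : forall n, pred (sgraph n);
  lcl_radius : nat;
  lcl_happy : forall n, sgraph n -> labeling lcl_label n -> pred 'I_n;
  lcl_happy_local : forall n (G : sgraph n) lam v m (G' : sgraph m) lam' v',
    same_gball lcl_radius G lam v G' lam' v' ->
    lcl_happy G lam v = lcl_happy G' lam' v'
}.

Section Mending.
Variable P : lcl.
Local Notation labeling n := (labeling (lcl_label P) n).

Definition partial_solution n (G : sgraph n) (lam : labeling n) : bool :=
  [forall u, [forall w in gball G (lcl_radius P) u, lam w != None]
             ==> lcl_happy G lam u].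

Definition is_hole n (lam : labeling n) : pred 'I_n := fun v => lam v == None.

Definition mending_instance n (G : sgraph n) (lam : labeling n) (v : 'I_n) :=
  [&& lcl_class P G, partial_solution G lam & is_hole lam v].

Definition is_mend n (G : sgraph n) (lam : labeling n) (v : 'I_n)
    (lam' : labeling n) : bool :=
  [&& partial_solution G lam', lam' v != None &
      [forall u, (lam u != None) ==> (lam' u != None)]].

Definition changed n (lam lam' : labeling n) : {set 'I_n} :=
  [set u | lam u != lam' u].

Definition always_mendable : Prop :=
  forall n (G : sgraph n) (lam : labeling n) (v : 'I_n),
    mending_instance G lam v -> exists lam', is_mend G lam v lam'.

(* The neutral element [n] of the minimum is an upper bound of all the
   quantities involved, so it plays no role when a mend exists. *)
Definition exists_MVol (n : nat) : nat :=
  \max_(G : sgraph n | lcl_class P G)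
  \max_(lam : labeling n | partial_solution G lam)
  \max_(v | is_hole lam v)
  \big[minn/n]_(lam' : labeling n | is_mend G lam v lam') #|changed lam lam'|.

Definition contains_mend n (G : sgraph n) (lam : labeling n) (v : 'I_n)
    (W : {set 'I_n}) : bool :=
  [exists lam', is_mend G lam v lam' && (changed lam lam' \subset W)].

(* - Exploration is only required of the states containing the start vertex
     [v], which are the only ones that can be reached: it contradicts
     termination at, e.g., the empty set.
   - In locality, the information available at [W] consists of the list of
     neighbours of each vertex of [W] and of the labels on [W] and on its
     neighbours.  Vertices keep their names, and the two graphs may have
     different sizes, so that the size of the graph is not available.  Whether
     [W] contains a mend may depend on vertices beyond the direct neighbourhood
     of [W]; the behaviour of the chain at the states that do contain one is
     already prescribed by termination, and locality constrains the others. *)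
Record mender (R : realType) := Mender {
  chain : forall n, sgraph n -> labeling n -> 'I_n ->
    {set 'I_n} -> {set 'I_n} -> R;
  chain_ge0 : forall n (G : sgraph n) lam v (W W' : {set 'I_n}),
    mending_instance G lam v -> 0 <= chain G lam v W W';
  chain_sum1 : forall n (G : sgraph n) lam v (W : {set 'I_n}),
    mending_instance G lam v -> \sum_W' chain G lam v W W' = 1;
  chain_progress : forall n (G : sgraph n) lam v (W W' : {set 'I_n}),
    mending_instance G lam v -> 0 < chain G lam v W W' -> W \subset W';
  chain_exploration : forall n (G : sgraph n) lam v (W W' : {set 'I_n}),
    mending_instance G lam v -> v \in W -> 0 < chain G lam v W W' ->
    W' \subset closed_nbh G W;
  chain_termination : forall n (G : sgraph n) lam v (W : {set 'I_n}),
    mending_instance G lam v ->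
    chain G lam v W W = 1 <-> contains_mend G lam v W;
  chain_locality : forall n m (le_nm : (n <= m)%N)
      (G : sgraph n) lam v (G' : sgraph m) lam' (W W1 : {set 'I_n}),
    let f := widen_ord le_nm in
    mending_instance G lam v -> mending_instance G' lam' (f v) ->
    {in W, forall u, G' (f u) = f @: G u} ->
    {in closed_nbh G W, forall u, lam' (f u) = lam u} ->
    ~~ contains_mend G lam v W -> ~~ contains_mend G' lam' (f v) (f @: W) ->
    chain G' lam' (f v) (f @: W) (f @: W1) = chain G lam v W W1
}.

Section ExpectedVolume.
Variables (R : realType) (M : mender R).

Fixpoint chain_iter n (G : sgraph n) lam v (t : nat) (W W' : {set 'I_n}) : R :=
  if t is t'.+1 then \sum_U chain M G lam v W U * chain_iter G lam v t' U W'
  else (W == W')%:R.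

Definition chain_lim n (G : sgraph n) lam v (W W' : {set 'I_n}) : R :=
  limn (fun t => chain_iter G lam v t W W').

Definition expected_volume n (G : sgraph n) lam v : R :=
  \sum_(W | chain M G lam v W W == 1) chain_lim G lam v [set v] W * #|W|%:R.

(* The volumes are nonnegative, so the neutral element 0 plays no role. *)
Definition EMVol n (G : sgraph n) : R :=
  \big[Num.max/0]_(lam : labeling n | partial_solution G lam)
  \big[Num.max/0]_(v | is_hole lam v) expected_volume G lam v.

End ExpectedVolume.

Local Open Scope classical_set_scope.

(* [T = o(f)] expresses [f = omega(T)]. *)
Definition has_EMVol_omega (R : realType) (T : nat -> R) : Prop :=
  forall M : mender R, exists G : forall n, sgraph n,
    (forall n, lcl_class P (G n)) /\ T =o_\oo (fun n => EMVol M (G n)).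

End Mending.

(* Main.v *)
Require Import Defs.
From HB Require Import structures.
From mathcomp Require Import all_boot all_order all_algebra all_fingroup.
From mathcomp Require Import all_classical all_reals all_analysis.
From mathcomp Require Import zify lra.
Set Implicit Arguments.
Unset Strict Implicit.
Unset Printing Implicit Defensive.
Import Order.TTheory GRing.Theory Num.Theory.
Import numFieldNormedType.Exports.
Local Open Scope ring_scope.

(* Label the vertices with bits.  A vertex of degree at least 5 must carry 1, and
   a vertex carrying 1 must have degree at most 2 or two neighbours carrying 1.

   Every vertex lies in a set of O(log n) vertices whose members all have degree
   at most 2 or two neighbours in the set: walks from a vertex double at each
   step, so within log n steps one reaches a vertex of degree at most 2 or two of
   them meet.  Labelling with 1 such sets around the neighbourhood of a hole
   mends it, so the existential mending volume is O(log n).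

   For the lower bound, glue three uniformly random matchings on n vertices and
   add a root of degree 5.  When only the root is a hole and all other labels are
   0, a mend needs a set around the root with no dead end, that is a cycle.  A
   mender that has explored fewer than k vertices sees a tree, except with
   probability O(k^2 / n), because each newly revealed partner is almost uniform.
   With k of order sqrt n, some graph has expected mending volume at least k/2. *)

(** * The labelling problem and its verifier of radius 1 *)

Definition ones n (lam : labeling bool n) : {set 'I_n} :=
  [set u | lam u == Some true].

Definition supported n (G : sgraph n) (S : {set 'I_n}) (u : 'I_n) : bool :=
  ((#|G u| <= 2) || (1 < #|G u :&: S|))%N.

Definition anchored_happy n (G : sgraph n) (lam : labeling bool n) (u : 'I_n) :=
  ((4 < #|G u|)%N ==> (u \in ones lam)) &&
  ((u \in ones lam) ==> supported G (ones lam) u).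

Lemma gball1 n (G : sgraph n) (v : 'I_n) : gball G 1 v = v |: G v.
Proof. by rewrite /gball /= /closed_nbh big_set1. Qed.

(** An isomorphism of balls restricts to a bijection from [G v] onto [G' v'] that preserves labels,
    hence it preserves the two cardinals and the membership from which the verdict is computed. *)
Lemma anchored_happy_local n (G : sgraph n) lam v m (G' : sgraph m) lam' v' :
  same_gball 1 G lam v G' lam' v' ->
  anchored_happy G lam v = anchored_happy G' lam' v'.
Proof.
case=> f []; rewrite !gball1 => fv injf imf adjf labf.
have vB : v \in v |: G v by rewrite finset.setU11.
have NB w : w \in G v -> w \in v |: G v by move=> ?; rewrite finset.setU1r.
have injN : {in G v &, injective f}.
  by move=> x y /NB xB /NB yB; apply: injf.
have onesE x : x \in v |: G v -> (f x \in ones lam') = (x \in ones lam).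
  by move=> xB; rewrite !inE labf.
have NE : G' v' = f @: G v.
  apply/setP => z; apply/idP/imsetP => [zG|[x xG ->]].
    have : z \in v' |: G' v' by rewrite finset.setU1r.
    rewrite -imf => /imsetP[x xB zE]; exists x => //.
    by rewrite -(adjf _ _ vB xB) fv -zE.
  by rewrite -fv (adjf _ _ vB) ?NB.
have NSE : G' v' :&: ones lam' = f @: (G v :&: ones lam).
  rewrite NE; apply/setP => z; apply/finset.setIP/imsetP => [[/imsetP[x xG ->]]|[x]].
    by rewrite onesE ?NB // => xo; exists x => //; rewrite inE xG.
  by case/finset.setIP => xG xo ->; rewrite imset_f // onesE ?NB.
have cN : #|G' v'| = #|G v| by rewrite NE card_in_imset.
have cNS : #|G' v' :&: ones lam'| = #|G v :&: ones lam|.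
  rewrite NSE card_in_imset // => x y /finset.setIP[xG _] /finset.setIP[yG _]; exact: injN.
by rewrite /anchored_happy /supported cN cNS -fv onesE.
Qed.

Definition anchored_lcl : lcl :=
  Lcl (fun n (G : sgraph n) => max_degree_le 5 G) anchored_happy_local.

Lemma sgraph_sym n (G : sgraph n) u w : (w \in G u) = (u \in G w).
Proof. by have /forallP/(_ u)/andP[_ /forallP/(_ w)/eqP] := valP G. Qed.

Lemma sgraph_irr n (G : sgraph n) u : u \notin G u.
Proof. by have /forallP/(_ u)/andP[] := valP G. Qed.

(** * Small self-supported sets *)

Section SupportedSets.
Context (n : nat) (G : sgraph n).
Implicit Types (p q x y z w e u v : 'I_n) (P S V : {set 'I_n}).

Lemma supportedS S S' u : S \subset S' -> supported G S u -> supported G S' u.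
Proof.
rewrite /supported => sSS' /orP[->//|lt1]; apply/orP; right.
by apply: leq_trans lt1 _; apply/subset_leq_card/finset.setIS.
Qed.

Lemma supported2 S u x y : x != y -> x \in G u -> y \in G u ->
  x \in S -> y \in S -> supported G S u.
Proof.
move=> xy xG yG xS yS; apply/orP; right.
rewrite -[2%N](_ : #|[set x; y]| = 2%N); last by rewrite cards2 xy.
by apply/subset_leq_card/fintype.subsetP => z /finset.set2P[]->; rewrite inE ?xG ?xS ?yG ?yS.
Qed.

(** A branch at [p] through [x]: it may rely on [p] for support, and two of them at distinct
    neighbours support [p] in return. *)
Definition arm p x P := (x \in P) && [forall w in P, supported G (p |: P) w].

(* [P] is a non-backtracking walk that enters at [x] from [p] and stops at [q],
   having reached [q] from [r]; only the end [q] may lack support. *)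
Definition walk_to p x r q P :=
  [&& x \in P, q \in P, r \in G q, r \in p |: P &
      [forall w in P, (w != q) ==> supported G (p |: P) w]].

(* Non-backtracking walks from [p] through [x] double at every step until two of
   them meet or one reaches a vertex of degree at most 2. *)
Lemma arm_or_growth p x m : x \in G p ->
  (exists2 P, arm p x P & #|P| <= m.*2.+1)%N \/
  (exists V (pr : 'I_n -> 'I_n), (2 ^ m <= #|V|)%N /\
     forall q, q \in V -> exists2 P, walk_to p x (pr q) q P & (#|P| <= m.+1)%N).
Proof.
move=> xp; elim: m => [|m [[P aP cP]|[V [pr [cV wV]]]]].
- right; exists [set x], (fun=> p); split; first by rewrite cards1.
  move=> q /finset.set1P->; exists [set x]; last by rewrite cards1.
  rewrite /walk_to !set11 sgraph_sym xp finset.setU11 /=.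
  by apply/forall_inP => w /finset.set1P->; rewrite eqxx.
- by left; exists P => //; apply: leq_trans cP _; rewrite doubleS ltnW.
(* An end of degree at most 2 needs no support, so its walk is already an arm. *)
have [/existsP[q /andP[qV dq]]|/existsPn nfree] :=
    boolP [exists q, (q \in V) && (#|G q| <= 2)%N].
  left; have [P /and5P[xP qP _ _ /forall_inP sP] cP] := wV q qV; exists P.
    rewrite /arm xP; apply/forall_inP => w wP.
    by have [->|wq] := eqVneq w q; [rewrite /supported dq | rewrite (implyP (sP w wP))].
  by apply: leq_trans cP _; lia.
(* Two walks with distinct ends that continue to a common vertex [e] close up: [e] gives each end
   its second neighbour, and the ends support [e]. *)
have [/existsP[q /existsP[q' /existsP[e]]]|/existsPn ncol] :=
    boolP [exists q, exists q', exists e,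
      [&& q \in V, q' \in V, q != q', e \in G q :\ pr q & e \in G q' :\ pr q']].
  case/and5P=> qV q'V qq' /finset.setD1P[epr eq] /finset.setD1P[epr' eq'].
  left; have [P /and5P[xP qP rq rP /forall_inP sP] cP] := wV q qV.
  have [P' /and5P[xP' qP' rq' rP' /forall_inP sP'] cP'] := wV q' q'V.
  exists (e |: (P :|: P')).
    rewrite /arm !inE xP orbT /=; apply/forall_inP => w; rewrite !inE.
    have s1 : p |: P \subset p |: (e |: (P :|: P')).
      by apply/finset.setUS/fintype.subsetP => z zP; rewrite !inE zP !orbT.
    have s2 : p |: P' \subset p |: (e |: (P :|: P')).
      by apply/finset.setUS/fintype.subsetP => z zP; rewrite !inE zP !orbT.
    case/or3P => [/eqP->|wP|wP].
    - apply: (@supported2 _ _ q q') => //; rewrite 1?sgraph_sym //.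
      + by rewrite !inE qP !orbT.
      + by rewrite !inE qP' !orbT.
    - have [->|wq] := eqVneq w q; last first.
        exact: supportedS s1 (implyP (sP w wP) wq).
      apply: (@supported2 _ _ e (pr q)) => //; first by rewrite !inE eqxx orbT.
      exact: (fintype.subsetP s1).
    - have [->|wq] := eqVneq w q'; last first.
        exact: supportedS s2 (implyP (sP' w wP) wq).
      apply: (@supported2 _ _ e (pr q')) => //; first by rewrite !inE eqxx orbT.
      exact: (fintype.subsetP s2).
  rewrite finset.cardsU1 doubleS -addnn.
  apply: (@leq_trans (1 + (m.+1 + m.+1))%N); last by rewrite addSn addnS.
  apply: leq_add; first by case: (_ \notin _).
  by rewrite (leq_trans (leq_card_setU _ _)) // leq_add.
(* Otherwise the continuations of distinct ends are disjoint, and each end has at least 2 of them,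
   since its degree is at least 3 and only its predecessor is removed. *)
right; pose nx q := if q \in V then G q :\ pr q else finset.set0.
exists (\bigcup_q nx q), (fun e => odflt e [pick q | e \in nx q]).
split; last first.
  move=> e /finset.bigcupP[q0 _ eq0]; case: pickP => [q|/(_ q0)]; last by rewrite eq0.
  rewrite /nx; case: ifP => [qV eq|]; last by rewrite finset.in_set0.
  have [P /and5P[xP qP rq rP /forall_inP sP] cP] := wV q qV.
  case/finset.setD1P: eq => epr eq /=; exists (e |: P).
    have s1 : p |: P \subset p |: (e |: P) by apply/finset.setUS/finset.subsetUr.
    rewrite /walk_to !inE eqxx xP qP !orbT /= sgraph_sym eq /=.
    apply/forall_inP => w /finset.setU1P[->|wP]; first by rewrite eqxx.
    apply/implyP => we; have [->|wq] := eqVneq w q; last first.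
      exact: supportedS s1 (implyP (sP w wP) wq).
    apply: (@supported2 _ _ e (pr q)) => //; first by rewrite !inE eqxx orbT.
    exact: (fintype.subsetP s1).
  by rewrite finset.cardsU1; case: (_ \notin _); rewrite ?ltnS // ltnW.
have disj q q' : q != q' -> [disjoint nx q & nx q'].
  move=> qq'; rewrite -finset.setI_eq0; apply/finset.set0Pn => -[e /finset.setIP[]].
  rewrite /nx; case: ifP => qV; last by rewrite finset.in_set0.
  case: ifP => q'V; last by rewrite finset.in_set0.
  move=> e1 e2.
  by have /existsPn/(_ q')/existsPn/(_ e) := ncol q; rewrite qV q'V qq' e1 e2.
rewrite -sum1_card finset.partition_disjoint_bigcup //.
apply: (@leq_trans (\sum_(q in V) 2)%N).
  by rewrite sum_nat_const expnSr leq_mul2r cV orbT.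
rewrite big_mkcond; apply: leq_sum => q _; rewrite sum1_card /nx.
case: ifP => // qV; have := nfree q; rewrite qV /= -ltnNge.
have [P /and5P[_ _ rq _ _] _] := wV q qV.
by rewrite (cardsD1 (pr q)) rq.
Qed.

(** With [n < 2 ^ m], growth would produce more ends than there are vertices. *)
Lemma exists_arm p x m : x \in G p -> (n < 2 ^ m)%N ->
  exists2 P, arm p x P & (#|P| <= m.*2.+1)%N.
Proof.
move=> xp nm; have [//|[V [pr [cV _]]]] := arm_or_growth m xp.
by have := leq_trans cV (max_card _); rewrite card_ord leqNgt nm.
Qed.

Definition self_supported S := [forall w in S, supported G S w].

Lemma self_supportedU S S' :
  self_supported S -> self_supported S' -> self_supported (S :|: S').
Proof.
move=> /forall_inP sS /forall_inP sS'; apply/forall_inP => w /finset.setUP[] wS.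
  exact: supportedS (finset.subsetUl _ _) (sS _ wS).
exact: supportedS (finset.subsetUr _ _) (sS' _ wS).
Qed.

(** Unless [u] has degree at most 2, two arms at distinct neighbours of [u] support it and are
    supported with its help; this gives [1 + 2 * (2 * m + 1)] vertices. *)
Lemma exists_self_supported u m : (n < 2 ^ m)%N ->
  exists S, [/\ u \in S, self_supported S & #|S| <= m.*2.+1.*2.+1]%N.
Proof.
move=> nm; have [du|du] := leqP #|G u| 2.
  exists [set u]; rewrite cards1; split; rewrite ?set11 //.
  by apply/forall_inP => w /finset.set1P->; rewrite /supported du.
have /card_gt1P[x [y [xu yu xy]]] : (1 < #|G u|)%N by apply: ltnW.
have [P /andP[xP /forall_inP sP] cP] := exists_arm xu nm.
have [P' /andP[yP' /forall_inP sP'] cP'] := exists_arm yu nm.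
exists (u |: (P :|: P')); split; first exact: finset.setU11.
  apply/forall_inP => w /finset.setU1P[->|].
    by apply: (@supported2 _ _ x y); rewrite // !inE ?xP ?yP' ?orbT.
  case/finset.setUP => [/sP|/sP']; apply: supportedS; apply: finset.setUS.
    exact: finset.subsetUl.
  exact: finset.subsetUr.
have cPP : (#|P :|: P'| <= m.*2.+1 + m.*2.+1)%N.
  by rewrite (leq_trans (leq_card_setU _ _)) // leq_add.
by rewrite finset.cardsU1; case: (u \notin _); lia.
Qed.

End SupportedSets.

(** * Existence of small mends *)

Section Mends.
Context (n : nat) (G : sgraph n) (lam : labeling bool n) (v : 'I_n).

(* The other holes stay unlabelled, so that every vertex outside [U] whose
   neighbourhood is fully labelled by [flood U] was already happy. *)
Definition flood (U : {set 'I_n}) : labeling bool n :=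
  [ffun u => if (u \in U) && ((u == v) || (lam u != None)) then Some true
             else lam u].

(** A vertex of [U] with fully labelled neighbourhood sees 1 on all its neighbours in [U], so it
    inherits its support from [U]. A vertex outside [U] is neither [v] nor adjacent to [v] and keeps
    its label; additional 1s around it only help. *)
Lemma flood_mend (U : {set 'I_n}) :
  partial_solution (P := anchored_lcl) G lam ->
  v |: G v \subset U -> self_supported G U ->
  is_mend (P := anchored_lcl) G lam v (flood U).
Proof.
move=> ps /fintype.subsetP NU /forall_inP sU; apply/and3P; split.
- apply/forallP => u; apply/implyP => /forall_inP; rewrite gball1 => full.
  have onesU w : w \in U -> w \in u |: G u -> w \in ones (flood U).
    move=> wU /full; rewrite inE !ffunE wU /=.
    by case: (w == v) => //=; case: (lam w).
  have sones : ones lam \subset ones (flood U).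
    apply/fintype.subsetP => w; rewrite !inE !ffunE => /eqP ->.
    by case: ifP.
  have [uU|uU] := boolP (u \in U).
    have u1 : u \in ones (flood U) by apply: onesU => //; rewrite finset.setU11.
    rewrite /= /anchored_happy u1 implybT /=.
    move: (sU u uU); rewrite /supported => /orP[->//|lt1]; apply/orP; right.
    apply: leq_trans lt1 _; apply: subset_leq_card; apply/fintype.subsetP => w.
    case/finset.setIP => wG wU; apply/finset.setIP; split=> //.
    by apply: onesU => //; rewrite finset.setU1r.
  have same : u \in ones (flood U) = (u \in ones lam).
    by rewrite !inE ffunE (negPf uU).
  have /implyP/(_ _)/andP[] := forallP ps u.
    apply/forall_inP => w; rewrite gball1 => wB.
    have wv : w != v.
      apply: contraNneq uU => wv; apply: NU; move: wB.
      by rewrite wv !inE sgraph_sym eq_sym.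
    move: (full w wB); rewrite ffunE (negPf wv) /=.
    by case: (lam w); rewrite ?andbF.
  rewrite /= /anchored_happy same => -> /= /implyP h; apply/implyP => /h.
  exact: supportedS.
- by rewrite ffunE NU ?eqxx // finset.setU11.
- by apply/forallP => u; apply/implyP => lu; rewrite ffunE lu orbT andbT; case: ifP.
Qed.

Lemma flood_changed (U : {set 'I_n}) : changed (P := anchored_lcl) lam (flood U) \subset U.
Proof.
apply/fintype.subsetP => u; rewrite inE ffunE; case: (u \in U) => //=.
by rewrite eqxx.
Qed.

Lemma exists_mend_card m : (n < 2 ^ m)%N -> max_degree_le 5 G ->
  partial_solution (P := anchored_lcl) G lam ->
  exists2 lam', is_mend (P := anchored_lcl) G lam v lam' &
    (#|changed (P := anchored_lcl) lam lam'| <= 6 * m.*2.+1.*2.+1)%N.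
Proof.
move=> nm dG ps; set b := m.*2.+1.*2.+1.
have [S hS] := choice (fun u => exists_self_supported G u nm).
(* The factor 6 counts [v] and its at most 5 neighbours. *)
pose U := \bigcup_(u in v |: G v) S u.
exists (flood U); last first.
  apply: leq_trans (subset_leq_card (flood_changed U)) _.
  apply: (@leq_trans (\sum_(u in v |: G v) b)%N).
    rewrite /U; elim/big_rec2: _ => [|u k A _ le]; first by rewrite finset.cards0.
    apply: leq_trans (leq_card_setU _ _) _; apply: leq_add le.
    by have [] := hS u.
  rewrite sum_nat_const leq_mul2r finset.cardsU1 (negPf (sgraph_irr _ _)) /=.
  by rewrite (_ : (_ <= 6)%N) ?orbT // add1n ltnS; apply: (forallP dG).
apply: flood_mend => //.
  apply/fintype.subsetP => u uN; apply/finset.bigcupP; exists u => //.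
  by have [] := hS u.
rewrite /U; elim/big_rec: _ => [|u A _ sA].
  by apply/forall_inP => w; rewrite finset.in_set0.
by apply: self_supportedU => //; have [] := hS u.
Qed.

End Mends.

Lemma anchored_always_mendable : always_mendable anchored_lcl.
Proof.
move=> n G lam v /and3P[dG ps _].
by have [lam' ? _] := exists_mend_card v (ltn_expl n (isT : 1 < 2)%N) dG ps; exists lam'.
Qed.

Lemma geq_bigminn (I : finType) (P : pred I) (F : I -> nat) x0 i :
  P i -> (\big[minn/x0]_(j | P j) F j <= F i)%N.
Proof.
move=> Pi; rewrite -big_filter.
have : i \in [seq j <- index_enum I | P j] by rewrite mem_filter Pi mem_index_enum.
elim: [seq _ <- _ | _] => // a s IH; rewrite inE big_cons => /predU1P[<-|/IH].
  exact: geq_minl.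
exact/leq_trans/geq_minr.
Qed.

Lemma anchored_MVol_le n m : (n < 2 ^ m)%N ->
  (exists_MVol anchored_lcl n <= 6 * m.*2.+1.*2.+1)%N.
Proof.
move=> nm; apply/bigmax_leqP => G dG; apply/bigmax_leqP => lam ps.
apply/bigmax_leqP => v _; have [lam' ml le] := exists_mend_card v nm dG ps.
exact: leq_trans (geq_bigminn _ _ ml) le.
Qed.

(** * Absorption of the exploration chain *)

Section MenderChain.
Context (R : realType) (P : lcl) (M : mender P R).
Context (n : nat) (G : sgraph n) (lam : labeling (lcl_label P) n) (v : 'I_n).
Hypothesis mi : mending_instance G lam v.
Local Notation c := (chain M G lam v).
Local Notation it := (chain_iter M G lam v).
Implicit Types U V W : {set 'I_n}.

Lemma chain_eq0 W W' : ~~ (W \subset W') -> c W W' = 0.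
Proof.
move=> nsub; apply/eqP; rewrite eq_le chain_ge0 // andbT leNgt.
by apply: contra nsub; apply: chain_progress.
Qed.

Lemma chain_iter_ge0 t W W' : 0 <= it t W W'.
Proof.
elim: t W => [|t IH] W /=; first by case: eqP.
by apply: sumr_ge0 => U _; rewrite mulr_ge0 ?chain_ge0.
Qed.

Lemma chain_iter_eq0 t W W' : ~~ (W \subset W') -> it t W W' = 0.
Proof.
elim: t W => [|t IH] W nsub /=.
  by case: eqP => // e; rewrite e fintype.subxx in nsub.
apply: big1 => U _; have [WU|WU] := boolP (W \subset U); last first.
  by rewrite chain_eq0 ?mul0r.
by rewrite IH ?mulr0 //; apply: contra nsub; apply: fintype.subset_trans.
Qed.

Lemma chain_iter_sum1 t W : \sum_W' it t W W' = 1.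
Proof.
elim: t W => [|t IH] W /=.
  by rewrite (bigD1 W) //= eqxx big1 ?addr0 // => U; rewrite eq_sym => /negPf->.
rewrite exchange_big /= -[RHS](chain_sum1 M W mi); apply: eq_bigr => U _.
by rewrite -mulr_sumr IH mulr1.
Qed.

Lemma chain_iterSr t W W' : it t.+1 W W' = \sum_U it t W U * c U W'.
Proof.
elim: t W => [|t IH] W /=.
  rewrite (bigD1 W') //= eqxx mulr1 big1 ?addr0 => [|U /negPf->]; last by rewrite mulr0.
  rewrite (bigD1 W) //= eqxx mul1r big1 ?addr0 // => U.
  by rewrite eq_sym => /negPf->; rewrite mul0r.
under eq_bigr => U _ do rewrite -/(chain_iter M G lam v t.+1 U W') IH mulr_sumr.
rewrite exchange_big; apply: eq_bigr => V _ /=.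
by rewrite mulr_suml; apply: eq_bigr => U _; rewrite mulrA.
Qed.

Local Notation q t W := (it t [set v] W).
Local Notation absorbing W := (c W W == 1).

Lemma chain_iter_le1 t W W' : it t W W' <= 1.
Proof.
rewrite -(chain_iter_sum1 t W) (bigD1 W') //= lerDl.
by apply: sumr_ge0 => U _; apply: chain_iter_ge0.
Qed.

Lemma chain_iter_absorbing_le t W : absorbing W -> q t W <= q t.+1 W.
Proof.
move=> /eqP abs; rewrite chain_iterSr (bigD1 W) //= abs mulr1 lerDl.
by apply: sumr_ge0 => U _; rewrite mulr_ge0 ?chain_ge0 ?chain_iter_ge0.
Qed.

Local Open Scope classical_set_scope.

(** The mass of an absorbing state never decreases and is at most 1, so [chain_lim] is a genuine
    limit there and not a default value. *)
Lemma chain_lim_cvg W : absorbing W ->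
  (fun t => q t W) @ \oo --> chain_lim M G lam v [set v]%SET W.
Proof.
move=> abs; apply/cvg_ex; exists (sup (range (fun t => q t W))).
apply: nondecreasing_cvgn.
  by apply/nondecreasing_seqP => t; apply: chain_iter_absorbing_le.
by exists 1 => _ [t _ <-]; apply: chain_iter_le1.
Qed.

Lemma le_chain_lim t W : absorbing W -> q t W <= chain_lim M G lam v [set v]%SET W.
Proof.
move=> abs; have cv := chain_lim_cvg abs.
rewrite /chain_lim; apply: (nondecreasing_cvgn_le (u_ := fun t => q t W)).
  by apply/nondecreasing_seqP => s; apply: chain_iter_absorbing_le.
by apply/cvg_ex; eexists; apply: cv.
Qed.

Lemma sum_chain_lim_le (A : pred {set 'I_n}) a :
  (forall W, A W -> absorbing W) ->
  (forall t, \sum_(W | A W) q t W <= a) ->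
  \sum_(W | A W) chain_lim M G lam v [set v]%SET W <= a.
Proof.
move=> Aabs le.
have cv : (fun t => \sum_(W | A W) q t W) @ \oo -->
    \sum_(W | A W) chain_lim M G lam v [set v]%SET W.
  by apply: cvg_big => [|W /Aabs]; [exact: add_continuous | exact: chain_lim_cvg].
rewrite -(cvg_lim _ cv) //; apply: limr_le.
  by apply/cvg_ex; eexists; apply: cv.
by near=> t; apply: le.
Unshelve. all: by end_near.
Qed.

(* As long as mass is left on transient states, the expected size of the
   explored set grows linearly in time, but it is at most [n]. *)
Lemma sum_absorbing_chain_lim :
  \sum_(W | absorbing W) chain_lim M G lam v [set v]%SET W = 1.
Proof.
apply/eqP; rewrite eq_le; apply/andP; split.
  apply: sum_chain_lim_le => // t; rewrite -[leRHS](chain_iter_sum1 t [set v]%SET).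
  rewrite [leRHS](bigID (fun W => absorbing W)) /= lerDl.
  by apply: sumr_ge0 => W _; apply: chain_iter_ge0.
set S := \sum_(W | _) _; rewrite leNgt; apply/negP => S1.
(* The least probability of leaving a transient state; the neutral element 1 keeps it positive if
   there is none. *)
pose d := \big[Num.min/1]_(W | ~~ absorbing W) (1 - c W W).
have cle1 W : c W W <= 1.
  rewrite -[leRHS](chain_sum1 M W mi) (bigD1 W) //= lerDl.
  by apply: sumr_ge0 => U _; apply: chain_ge0.
have d0 : 0 < d.
  rewrite /d; elim/big_ind: _ => // [x y x0 y0|W nW]; first by rewrite lt_min x0.
  by rewrite subr_gt0 lt_neqAle nW cle1.
pose e t := \sum_W q t W * #|W|%:R.
have trans t : 1 - S <= \sum_(W | ~~ absorbing W) q t W.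
  rewrite lerBlDr -[leLHS](chain_iter_sum1 t [set v]%SET).
  rewrite [leLHS](bigID (fun W => absorbing W)) /= addrC lerD2l.
  by apply: ler_sum => W abs; apply: le_chain_lim.
have step t : e t + d * (1 - S) <= e t.+1.
  rewrite /e; under [leRHS]eq_bigr => W _ do rewrite chain_iterSr mulr_suml.
  rewrite exchange_big /=.
  (* By progress, every move to a different state adds at least one vertex. *)
  have inner W : q t W * (#|W|%:R + (1 - c W W)) <=
      \sum_U q t W * c W U * #|U|%:R.
    under eq_bigr => U _ do rewrite -mulrA.
    rewrite -mulr_sumr; apply: ler_wpM2l; first exact: chain_iter_ge0.
    have -> : #|W|%:R + (1 - c W W) =
        \sum_U c W U * (#|W|%:R + (U != W)%:R) :> R.
      under eq_bigr => U _ do rewrite mulrDr.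
      rewrite big_split /= -mulr_suml chain_sum1 // mul1r; congr (_ + _).
      rewrite -[X in X - _](chain_sum1 M W mi) [RHS](bigD1 W) //= eqxx mulr0 add0r.
      rewrite [X in X - _](bigD1 W) //= addrAC subrr add0r.
      by apply: eq_bigr => U ->; rewrite mulr1.
    apply: ler_sum => U _; have [WU|WU] := boolP (W \subset U); last first.
      by rewrite chain_eq0 ?mul0r.
    apply: ler_wpM2l; first exact: chain_ge0.
    rewrite -natrD ler_nat; have [->|UW] := eqVneq U W; first by rewrite addn0.
    by rewrite addn1 proper_card // finset.properEneq eq_sym UW.
  apply: le_trans (ler_sum _ (fun W _ => inner W)).
  under [leRHS]eq_bigr => W _ do rewrite mulrDr.
  rewrite big_split /= lerD2l.
  apply: le_trans (ler_wpM2l (ltW d0) (trans t)) _.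
  rewrite [leRHS](bigID (fun W => absorbing W)) /= mulr_sumr.
  rewrite -[leLHS]add0r; apply: lerD.
    by apply: sumr_ge0 => W _; rewrite mulr_ge0 ?chain_iter_ge0 ?subr_ge0.
  apply: ler_sum => W nW; rewrite mulrC ler_wpM2l ?chain_iter_ge0 //.
  by rewrite /d (bigD1 W) //= ge_min lexx.
have lin t : t%:R * (d * (1 - S)) <= e t.
  elim: t => [|t IH].
    by rewrite mul0r; apply: sumr_ge0 => W _; rewrite mulr_ge0 ?chain_iter_ge0.
  by rewrite -natr1 mulrDl mul1r; apply: le_trans (step t); rewrite lerD2r.
have en t : e t <= n%:R.
  rewrite -[leRHS]mul1r -[X in X * _](chain_iter_sum1 t [set v]%SET) mulr_suml.
  apply: ler_sum => W _; apply: ler_wpM2l; first exact: chain_iter_ge0.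
  by rewrite ler_nat -[leqRHS]card_ord max_card.
have dS : 0 < d * (1 - S) by rewrite mulr_gt0 // subr_gt0.
(* A time at which the linear lower bound on [e] exceeds [n]. *)
pose t := (Num.truncn (n%:R / (d * (1 - S)))).+1.
have := le_trans (lin t) (en t); apply/negP; rewrite -ltNge -ltr_pdivrMr //.
exact: truncnS_gt.
Qed.

(** Absorption is almost sure, so absorbing sets of size at least [k] receive limiting mass at least
    [1 - a]. *)
Lemma expected_volume_ge k a :
  (forall t, \sum_(W | absorbing W && (#|W| < k)%N) q t W <= a) ->
  k%:R * (1 - a) <= expected_volume M G lam v.
Proof.
move=> /(sum_chain_lim_le (fun W => fun h => proj1 (andP h))) small.
rewrite /expected_volume (bigID (fun W : {set 'I_n} => (#|W| < k)%N)) /=.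
have lim0 W : absorbing W -> 0 <= chain_lim M G lam v [set v]%SET W.
  by move=> /(le_chain_lim 0); apply: le_trans; apply: chain_iter_ge0.
rewrite -[leLHS]add0r; apply: lerD.
  by apply: sumr_ge0 => W /andP[abs _]; rewrite mulr_ge0 ?lim0.
apply: (@le_trans _ _ (\sum_(W | absorbing W && ~~ (#|W| < k)%N)
    k%:R * chain_lim M G lam v [set v]%SET W)).
  rewrite -mulr_sumr ler_wpM2l // lerBlDl -[leLHS]sum_absorbing_chain_lim.
  by rewrite [leLHS](bigID (fun W : {set 'I_n} => (#|W| < k)%N)) /= lerD2r.
apply: ler_sum => W /andP[abs]; rewrite -leqNgt => kW.
by rewrite mulrC ler_wpM2l ?lim0 // ler_nat.
Qed.

Lemma sum_chain_iter_mono (A : pred {set 'I_n}) s t :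
  (forall W, A W -> absorbing W) -> (s <= t)%N ->
  \sum_(W | A W) q s W <= \sum_(W | A W) q t W.
Proof.
move=> Aabs /subnK <-; elim: (t - s)%N => [//|r IH]; rewrite addSn.
apply: le_trans IH _; apply: ler_sum => W /Aabs; exact: chain_iter_absorbing_le.
Qed.

End MenderChain.

(** * Random matchings around a root *)

Section MatchingGraph.
Context (n : nat).
Local Notation N := n.+1.
Definition matchings := {ffun 'I_3 -> {ffun 'I_N -> 'I_N}}.
Implicit Types (s : matchings) (u w x y z : 'I_N) (W S : {set 'I_N}).

(* The root is vertex 0, and its neighbours are the spokes. *)
Definition spoke x := (0 < x <= 5)%N.

(** Both directions of each map are included, so that any [s], involutive or not, yields a simple
    graph. *)
Definition matching_adj s u w : bool :=
  (u != w) && [|| [exists i, s i u == w], [exists i, s i w == u],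
                  (u == ord0) && spoke w | (w == ord0) && spoke u].

Definition matching_nbh s : {ffun 'I_N -> {set 'I_N}} :=
  [ffun u => [set w | matching_adj s u w]].

Lemma matching_nbh_simple s : simple_nbh (matching_nbh s).
Proof.
apply/forallP => u; apply/andP; split; first by rewrite !ffunE inE /matching_adj eqxx.
apply/forallP => w; rewrite !ffunE !inE /matching_adj eq_sym; apply/eqP.
by rewrite orbCA [_ && spoke w || _]orbC eq_sym.
Qed.

Definition matching_graph s : sgraph N := SGraph (matching_nbh_simple s).

Lemma in_matching_graph s u w : (w \in matching_graph s u) = matching_adj s u w.
Proof. by rewrite /= ffunE inE. Qed.

(* The root is left unmatched, and so is one further vertex if [N] is even. *)
Definition idle x := (x == ord0) || (~~ odd N && (x == ord_max)).

Definition matching_family s : bool :=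
  [forall i, forall x, (s i (s i x) == x) && ((s i x == x) == idle x)].

Section Family.
Variables (s : matchings) (fs : matching_family s).

Lemma matchingK i : involutive (s i).
Proof. by move=> x; have /forallP/(_ i)/forallP/(_ x)/andP[/eqP] := fs. Qed.

Lemma matching_idle i x : (s i x == x) = idle x.
Proof. by have /forallP/(_ i)/forallP/(_ x)/andP[_ /eqP] := fs. Qed.

Lemma matching0 i : s i ord0 = ord0.
Proof. by apply/eqP; rewrite matching_idle /idle eqxx. Qed.

Lemma matching_eq0 i x : (s i x == ord0) = (x == ord0).
Proof. by rewrite -[in LHS](matching0 i) (inj_eq (can_inj (matchingK i))). Qed.

Lemma matching_adjE u w : matching_adj s u w =
  (u != w) && [|| [exists i, s i u == w],
                  (u == ord0) && spoke w | (w == ord0) && spoke u].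
Proof.
congr (_ && _); rewrite orbA; congr (_ || _); apply/orP/idP => [[]//|]; last by left.
by case/existsP => i /eqP <-; apply/existsP; exists i; rewrite matchingK.
Qed.

Lemma matching_graphE u : matching_graph s u =
  ([set s i u | i : 'I_3] :\ u) :|: (if u == ord0 then [set w | spoke w] else
    if spoke u then [set ord0] else finset.set0).
Proof.
apply/setP => w; rewrite in_matching_graph matching_adjE !inE eq_sym.
have -> : (w \in [set s i u | i : 'I_3]) = [exists i, s i u == w].
  by apply/imsetP/existsP => [[i _ ->]|[i /eqP <-]]; exists i.
have [->|u0] /= := eqVneq u ord0.
  rewrite !inE /spoke /= andbF orbF andb_orr; congr (_ || _).
  by case: (eqVneq w ord0) => [->|].
have [us|us] := boolP (spoke u); last by rewrite !inE andbF !orbF.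
rewrite !inE andbT andb_orr; congr (_ || _).
by case: (eqVneq w ord0) => [->|]; rewrite ?andbF // eq_sym u0.
Qed.

End Family.

Lemma matching_graph_agree s s' u : matching_family s -> matching_family s' ->
  (forall i, s i u = s' i u) -> matching_graph s u = matching_graph s' u.
Proof.
by move=> fs fs' e; rewrite !matching_graphE //; under eq_imset do rewrite e.
Qed.

Hypothesis n_gt5 : (5 < n)%N.

Lemma card_spoke : #|[set w : 'I_N | spoke w]| = 5%N.
Proof.
rewrite -[RHS](card_ord 5) -[RHS](card_imset (f := fun i : 'I_5 => (inord i.+1 : 'I_N))).
  congr #|pred_of_set _|; apply/setP => w; rewrite inE; apply/idP/imsetP => [/andP[w0 w5]|[i _ ->]].
    have w4 : (w.-1 < 5)%N by lia.
    by exists (Ordinal w4) => //; apply/val_inj; rewrite /= prednK // inordK.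
  by rewrite /spoke inordK //= ?ltn_ord //; have := ltn_ord i; lia.
move=> i j /(congr1 val) /=; rewrite !inordK; last 2 first.
- by have := ltn_ord j; lia.
- by have := ltn_ord i; lia.
by case=> /val_inj.
Qed.

Lemma matching_degree0 s : matching_family s -> #|matching_graph s ord0| = 5%N.
Proof.
move=> fs; rewrite matching_graphE // eqxx -[RHS]card_spoke.
congr #|pred_of_set _|; apply/setP => w; rewrite !inE.
apply/orP/idP => [[/andP[w0 /imsetP[i _ e]]|//]|->]; last by right.
by rewrite e matching0 // eqxx in w0.
Qed.

Lemma matching_degree s u : matching_family s -> u != ord0 ->
  (#|matching_graph s u| <= 4)%N.
Proof.
move=> fs u0; rewrite matching_graphE // (negPf u0).
apply: leq_trans (leq_card_setU _ _) _; rewrite -[4%N]/(3 + 1)%N leq_add //.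
  apply: leq_trans (subset_leq_card (finset.subD1set _ _)) _.
  by apply: leq_trans (leq_imset_card _ _) _; rewrite card_ord.
by case: ifP => _; rewrite ?finset.cards1 ?finset.cards0.
Qed.

Lemma matching_graph_max_degree s : matching_family s -> max_degree_le 5 (matching_graph s).
Proof.
move=> fs; apply/forallP => u; have [->|u0] := eqVneq u ord0.
  by rewrite matching_degree0.
exact: leq_trans (matching_degree fs u0) _.
Qed.

Definition root_hole : labeling bool N := [ffun u => if u == ord0 then None else Some false].

(** Only the root has degree above 4, and it is a hole; every other vertex may carry 0. *)
Lemma root_hole_instance s : matching_family s ->
  mending_instance (P := anchored_lcl) (matching_graph s) root_hole ord0.
Proof.
move=> fs; apply/and3P; split.
- exact: matching_graph_max_degree.
- apply/forallP => u; apply/implyP => /forall_inP full.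
  have u0 : u != ord0.
    apply/eqP => u0; have := full u.
    by rewrite gball1 finset.setU11 ffunE u0 => /(_ isT).
  rewrite /= /anchored_happy leqNgt ltnS matching_degree //=.
  by rewrite inE ffunE (negPf u0).
- by rewrite /is_hole ffunE eqxx.
Qed.

(** * Explored sets without a cycle *)

Definition sparse s W : bool :=
  [forall S : {set 'I_N}, (S \subset W) && (S != finset.set0) ==>
    ~~ self_supported (matching_graph s) S].

Lemma sparseS s W W' : W \subset W' -> sparse s W' -> sparse s W.
Proof.
move=> sub /forallP sp; apply/forallP => S; apply/implyP => /andP[SW S0].
by apply: (implyP (sp S)); rewrite S0 (fintype.subset_trans SW).
Qed.

Lemma sparse_agree s s' W : matching_family s -> matching_family s' ->
  {in W, forall u i, s i u = s' i u} -> sparse s W -> sparse s' W.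
Proof.
move=> fs fs' e /forallP sp; apply/forallP => S; apply/implyP => SWS.
have := implyP (sp S) SWS; apply: contra => /forall_inP sS.
apply/forall_inP => u uS; move: (sS u uS); rewrite /supported.
case/andP: SWS => /fintype.subsetP/(_ u uS) uW _.
by rewrite (@matching_graph_agree s s') // => i; apply: e.
Qed.

(** The root is the only hole, so a mend labels everything and makes every vertex happy. Its set of
    1s then contains the root, is self-supported, and consists of changed vertices because
    [root_hole] has no 1. *)
Lemma sparse_no_mend s W : matching_family s -> sparse s W ->
  ~~ contains_mend (P := anchored_lcl) (matching_graph s) root_hole ord0 W.
Proof.
move=> fs /forallP sp; apply/existsP => -[lam' /andP[]].
case/andP=> ps /andP[v0 keep] ch.
have full u : lam' u != None.
  have [->//|u0] := eqVneq u ord0; apply: (implyP (forallP keep u)).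
  by rewrite ffunE (negPf u0).
have happy u : anchored_happy (matching_graph s) lam' u.
  by apply: (implyP (forallP ps u)); apply/forall_inP.
have := sp (ones lam'); apply/negP; rewrite negb_imply negbK -andbA; apply/and3P; split.
- apply: fintype.subset_trans ch; apply/fintype.subsetP => u; rewrite !inE ffunE => /eqP ->.
  by case: ifP.
- apply/finset.set0Pn; exists ord0; have /andP[/implyP h _] := happy ord0.
  by apply: h; rewrite matching_degree0.
- by apply/forall_inP => u u1; have /andP[_ /implyP] := happy u; apply.
Qed.

(* [W] is explored without having met a cycle, and no vertex outside [W] would
   close one. *)
Definition clean s W : bool :=
  sparse s W && [forall z, (z \notin W) ==> [forall i, (s i z \in W) ==>
    ~~ spoke z && [forall j, (s j z \in W) ==> (i == j)]]].

(** The second clause of [clean] constrains only those outside vertices that have a partner in [W];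
    by involutivity these are partners of vertices of [W], hence determined by the explored part. *)
Lemma clean_agree s s' W : matching_family s -> matching_family s' ->
  {in W, forall u i, s i u = s' i u} -> clean s W -> clean s' W.
Proof.
move=> fs fs' e /andP[sp /forallP out]; rewrite /clean (sparse_agree fs fs' e) //=.
have back z i : s' i z \in W -> s i z = s' i z.
  by move=> zW; apply: (can_inj (matchingK fs i)); rewrite matchingK // e // matchingK.
apply/forallP => z; apply/implyP => zW; apply/forallP => i; apply/implyP => iW.
have iW' := iW; rewrite -(back _ _ iW) in iW'.
have /andP[-> /forallP uni] := implyP (forallP (implyP (out z) zW) i) iW'.
apply/forallP => j; apply/implyP => jW; apply: (implyP (uni j)).
by rewrite (back _ _ jW).
Qed.

Lemma clean_root s : matching_family s -> clean s [set ord0].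
Proof.
move=> fs; apply/andP; split.
  apply/forallP => S; apply/implyP => /andP[]; rewrite finset.subset1 => /orP[]/eqP -> //.
    move=> _; apply/negP => /forall_inP/(_ ord0 (finset.set11 _)).
    rewrite /supported matching_degree0 //= ltnNge -[1%N](finset.cards1 (ord0 : 'I_N)).
    by rewrite subset_leq_card // finset.subsetIr.
  by rewrite eqxx.
apply/forallP => z; apply/implyP => z0; apply/forallP => i.
by rewrite !inE matching_eq0 // in z0 *; rewrite (negPf z0).
Qed.

Lemma idle_nonspoke x : idle x -> ~~ spoke x.
Proof.
rewrite /idle /spoke => /orP[/eqP->//|/andP[_ /eqP->]] /=; lia.
Qed.

Lemma mem_closed_nbh m (G : sgraph m) (W : {set 'I_m}) (u : 'I_m) :
  u \in closed_nbh G W -> u \notin W -> exists2 w, w \in W & w \in G u.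
Proof.
rewrite inE => /orP[->//|/finset.bigcupP[w wW uw] _]; exists w => //.
by rewrite sgraph_sym.
Qed.

(** The two kinds of coincidence: [None] for hitting the vertex [y] itself, [Some k] for hitting the
    [k]-th partner of [y]. *)
Definition target s (j : option 'I_3) y := if j is Some k then s k y else y.

(* Exploring [W' :\: W] can only spoil cleanness through a coincidence: a newly
   revealed partner of some [u] is a known vertex or is revealed twice. *)
Lemma collision s W W' : matching_family s -> ord0 \in W -> clean s W ->
  W \subset W' -> W' \subset closed_nbh (matching_graph s) W -> ~~ clean s W' ->
  exists u i j y, [/\ u \in W' :\: W, ~~ idle u, y \in W' :|: [set y | spoke y],
    j != Some i & (s i u \notin W) && (s i u == target s j y)].
Proof.
move=> fs W0 /andP[sp /forallP out] sub cl; apply: contraNP => none.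
have ok u i j y : u \in W' -> u \notin W -> ~~ idle u -> s i u \notin W ->
    j != Some i -> y \in W' :|: [set y | spoke y] -> s i u != target s j y.
  move=> uW' uW iu siu ji yW; apply/negP => /eqP e; apply: none.
  exists u, i, j, y; split=> //; first by rewrite inE uW.
  by rewrite siu e eqxx.
have uni z i j : z \notin W -> s i z \in W -> s j z \in W -> i = j.
  move=> zW iW jW.
  have /andP[_ /forallP u] := implyP (forallP (implyP (out z) zW) i) iW.
  by apply/eqP; apply: (implyP (u j)).
have nspoke z i : z \notin W -> s i z \in W -> ~~ spoke z.
  by move=> zW iW; have /andP[] := implyP (forallP (implyP (out z) zW) i) iW.
have parent u : u \in W' -> u \notin W -> (exists i, s i u \in W) \/ spoke u.
  move=> uW' uW; have [w wW] := mem_closed_nbh (fintype.subsetP cl _ uW') uW.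
  rewrite in_matching_graph matching_adjE // => /andP[_].
  case/or3P => [/existsP[i /eqP e]|/andP[/eqP u0]|/andP[_ ->]]; last by right.
    by left; exists i; rewrite e.
  by rewrite u0 W0 in uW.
have nidle u : u \in W' -> u \notin W -> ~~ idle u.
  move=> uW' uW; apply/negP => iu; case: (parent u uW' uW) => [[i]|]; last first.
    by apply/negP/idle_nonspoke.
  by move: iu; rewrite -(matching_idle fs i) => /eqP ->; apply/negP.
have new u i : u \in W' -> u \notin W -> s i u \notin W -> s i u \notin W'.
  move=> uW' uW siu; apply/negP => h.
  have := ok u i None (s i u) uW' uW (nidle u uW' uW) siu isT.
  by rewrite inE h /= eqxx => /(_ isT).
have newU u i j y : u \in W' -> u \notin W -> s i u \notin W -> y \in W' -> s i u = s j y -> i = j.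
  move=> uW' uW siu yW' e; apply/eqP; rewrite eq_sym; apply/negPn/negP => ij.
  have := ok u i (Some j) y uW' uW (nidle u uW' uW) siu ij.
  by rewrite inE yW' /= e eqxx => /(_ isT).
have newS u i : u \in W' -> u \notin W -> s i u \notin W -> ~~ spoke (s i u).
  move=> uW' uW siu; apply/negP => h.
  have := ok u i None (s i u) uW' uW (nidle u uW' uW) siu isT.
  by rewrite !inE h orbT /= eqxx => /(_ isT).
have kid u w : u \in W' -> u \notin W -> w \in matching_graph s u :&: W' ->
    (exists2 i, s i u = w & w \in W) \/ (w = ord0 /\ spoke u).
  move=> uW' uW /finset.setIP[]; rewrite in_matching_graph matching_adjE //.
  case/andP=> _ /or3P[/existsP[i /eqP e]|/andP[/eqP u0]|/andP[/eqP -> ->]] wW'; last by right.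
    left; exists i => //; apply/negPn/negP; rewrite -e => siu.
    by have := new u i uW' uW siu; rewrite e wW'.
  by rewrite u0 W0 in uW.
apply/andP; split.
  apply/forallP => S; apply/implyP => /andP[SW' S0]; apply/negP => /forall_inP sS.
  have [SW|/fintype.subsetPn[u uS uW]] := boolP (S \subset W).
    have := implyP (forallP sp S); rewrite SW S0 => /(_ isT).
    by move/negP; apply; apply/forall_inP.
  (* A new vertex [u] has three distinct partners, hence degree at least 3, but at most one
     neighbour in [W'], so it cannot be supported. *)
  have uW' := fintype.subsetP SW' u uS.
  have deg3 : (2 < #|matching_graph s u|)%N.
    rewrite -[3%N](card_ord 3) -(card_imset (f := fun i => s i u)); last first.
      move=> i j e; have [iW|iW] := boolP (s i u \in W); last exact: newU e.
      have [jW|jW] := boolP (s j u \in W); first exact: uni iW jW.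
      by apply/esym; apply: newU (esym e).
    apply: subset_leq_card; apply/fintype.subsetP => w /imsetP[i _ ->].
    rewrite in_matching_graph matching_adjE //; apply/andP; split.
      by rewrite eq_sym matching_idle // nidle.
    by apply/orP; left; apply/existsP; exists i.
  have := sS u uS; rewrite /supported leqNgt deg3 /= ltnNge; apply/negP; rewrite negbK.
  apply: (@leq_trans #|matching_graph s u :&: W'|).
    exact/subset_leq_card/finset.setIS.
  apply/card_le1P => w wN w'; have kw := kid u w uW' uW wN; rewrite [RHS]inE.
  apply/idP/eqP => [/(kid u w' uW' uW) kw'|->].
    case: kw kw' => [[i <- iW]|[-> su]] [[j <- jW]|[-> sj]] //.
    - by rewrite (uni u i j).
    - by have := nspoke u i uW iW; rewrite sj.
    - by have := nspoke u j uW jW; rewrite su.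
  exact: wN.
(* If [s i z] is new, then [z] is a newly revealed partner, and its being a spoke or having a second
   partner in [W'] would be a coincidence. *)
apply/forallP => z; apply/implyP => zW'; apply/forallP => i; apply/implyP => iW'.
have zW : z \notin W by apply: contra zW' => /(fintype.subsetP sub).
apply/andP; split.
  have [/(nspoke _ _ zW)//|iW] := boolP (s i z \in W).
  by have := newS (s i z) i iW' iW; rewrite matchingK //; apply.
apply/forallP => j; apply/implyP => jW'; apply/eqP.
have [iW|iW] := boolP (s i z \in W); last first.
  by apply: (newU (s i z) i j (s j z)); rewrite ?matchingK.
have [jW|jW] := boolP (s j z \in W); first exact: uni iW jW.
by apply/esym; apply: (newU (s j z) j i (s i z)); rewrite ?matchingK.
Qed.

(** * Switching partners in one matching *)

Definition swap s (i : 'I_3) t z : matchings :=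
  [ffun j => if j == i then [ffun x => tperm t z (s j (tperm t z x))] else s j].

Lemma swapK s i t z : swap (swap s i t z) i t z = s.
Proof.
apply/ffunP => j; rewrite !ffunE; case: eqP => // _.
by apply/ffunP => x; rewrite !ffunE !tpermK.
Qed.

(** A conjugate of an involution is an involution, and the transposition fixes every idle vertex, so
    the fixed points stay the same. *)
Lemma swap_family s i t z : ~~ idle t -> ~~ idle z ->
  matching_family s -> matching_family (swap s i t z).
Proof.
move=> it iz fs; apply/forallP => j; apply/forallP => x; rewrite !ffunE.
case: (j =P i) => [->|_]; last by rewrite matchingK // matching_idle // !eqxx.
rewrite !ffunE tpermK matchingK // tpermK eqxx /=.
have idleT : idle (tperm t z x) = idle x.
  by case: tpermP => [->|->|//]; rewrite (negPf it) (negPf iz).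
by rewrite -(inj_eq (@perm_inj _ (tperm t z))) tpermK matching_idle // idleT.
Qed.

Lemma swap_agree s i t z W : t \notin W -> z \notin W -> s i t \notin W -> s i z \notin W ->
  matching_family s ->
  {in W, forall u j, s j u = swap s i t z j u}.
Proof.
move=> tW zW stW szW fs u uW j; rewrite !ffunE; case: eqP => // ->; rewrite ffunE.
have ne x : x \notin W -> x != u by apply: contraNneq => ->.
rewrite (tpermD (ne _ tW) (ne _ zW)) tpermD //.
  by apply: contraNneq stW => ->; rewrite matchingK.
by apply: contraNneq szW => ->; rewrite matchingK.
Qed.

Section Switching.
Variables (R : realType) (W : {set 'I_N}) (h : matchings -> R).
Hypothesis h_ge0 : forall s, 0 <= h s.
Hypothesis h_agree : forall s s', matching_family s -> matching_family s' ->
  {in W, forall u i, s i u = s' i u} -> h s = h s'.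

(* Switching the partner [T s] of [u] with any of almost all vertices [z] is
   injective in [(s, z)], because [z] can be read off as the new partner of [u]. *)
Lemma switching u i (T : matchings -> 'I_N) : u \notin W -> ~~ idle u ->
  (forall s t z, T (swap s i t z) = T s) ->
  (\sum_(s | [&& matching_family s, s i u \notin W & s i u == T s]) h s)
    * (n - (#|W|.*2 + 2))%:R <= \sum_(s | matching_family s) h s.
Proof.
move=> uW iu Tswap.
set E := (X in \sum_(s | X s) _).
(* Of the [n.+1] vertices this excludes [W], its partners, [u] and the at most two idle vertices,
   which leaves at least [n - (2 * #|W| + 2)]. *)
pose good s : {set 'I_N} := [set z | [&& z \notin W, s i z \notin W, z != u & ~~ idle z]].
have card_good s : matching_family s -> (n - (#|W|.*2 + 2) <= #|good s|)%N.
  move=> fs; rewrite leq_subLR.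
  have /subset_leq_card : [set: 'I_N] \subset
      (W :|: [set s i w | w in W]) :|: ([set u; ord0; ord_max] :|: good s).
    apply/fintype.subsetP => z _; rewrite !inE /idle.
    have -> : (z \in [set s i w | w in W]) = (s i z \in W).
      apply/imsetP/idP => [[w wW ->]|siz]; first by rewrite matchingK.
      by exists (s i z); rewrite ?matchingK.
    case: (z \in W) (s i z \in W) (z == u) (z == ord0) (z == ord_max) => [] [] [] [] [] //.
    by rewrite andbF.
  rewrite finset.cardsT card_ord => /leq_trans le.
  have := le _ (leq_card_setU _ _).
  have := (leq_card_setU W [set s i w | w in W]).1.
  have := (leq_card_setU [set u; ord0; ord_max] (good s)).1.
  have : (#|[set s i w | w in W]| <= #|W|)%N by exact: leq_imset_card.
  have : (#|[set u; ord0; ord_max]| <= 3)%N.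
    by rewrite finset.setUC finset.cardsU1 cards2; case: (_ \notin _); case: (_ == _).
  move=> c3 im B A lt; rewrite -ltnS; apply: leq_trans lt _.
  apply: leq_trans (leq_add A B) _.
  apply: leq_trans (leq_add (leq_add (leqnn _) im) (leq_add c3 (leqnn _))) _.
  by rewrite -addnn addnCA addnA !addnS !addn0 !addSn.
pose A : {set matchings * 'I_N} := [set p | E p.1 && (p.2 \in good p.1)].
pose f (p : matchings * 'I_N) := swap p.1 i (T p.1) p.2.
have fu p : p \in A -> f p i u = p.2.
  rewrite inE => /andP[/and3P[fs _ /eqP e]]; rewrite inE => /and4P[_ _ zu _].
  rewrite !ffunE eqxx ffunE (@tpermD _ (T p.1) p.2 u) // ?e ?tpermL //.
  by rewrite -e matching_idle.
(* Since [T] is invariant under swapping, the image determines [T p.1] as well as [p.2], and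
   swapping back recovers [p.1]. *)
have f_inj : {in A &, injective f}.
  move=> p q pA qA e; have e2 : p.2 = q.2 by rewrite -!fu // e.
  have eT : T p.1 = T q.1 by rewrite -(Tswap p.1 (T p.1) p.2) -/(f p) e Tswap.
  have e1 : p.1 = q.1.
    by rewrite -(swapK p.1 i (T p.1) p.2) -/(f p) e eT e2 swapK.
  by move: e1 e2; case: (p) (q) => [a b] [a' b'] /= -> ->.
have fP p : p \in A -> matching_family (f p) /\ h (f p) = h p.1.
  rewrite inE => /andP[/and3P[fs tW /eqP e]]; rewrite inE => /and4P[zW szW _ iz].
  have it : ~~ idle (T p.1).
    by rewrite -e -(matching_idle fs i) matchingK // eq_sym matching_idle.
  have ff := swap_family i it iz fs; split=> //.
  apply/esym/h_agree => //; apply: swap_agree => //; rewrite -e ?matchingK //.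
apply: (@le_trans _ _ (\sum_(p in A) h (f p))).
  rewrite mulr_suml (eq_bigl (fun p => E p.1 && (p.2 \in good p.1))); last first.
    by move=> p; rewrite inE.
  rewrite (eq_bigr (fun p => h p.1)); last by move=> p pA; apply: (fP p _).2; rewrite inE.
  rewrite -(pair_big_dep E (fun s z => z \in good s) (fun s _ => h s)) /=.
  apply: ler_sum => s /and3P[fs _ _]; rewrite sumr_const -[leRHS]mulr_natr.
  by apply: ler_wpM2l => //; rewrite ler_nat card_good.
rewrite -(big_imset _ f_inj) /= [leRHS](bigID (mem (f @: A))) /=.
rewrite (eq_bigl (fun s => matching_family s && (s \in f @: A))); last first.
  move=> s; apply/idP/andP => [sA|[]//]; split=> //.
  by have /imsetP[p pA ->] := sA; have [] := fP p pA.
by rewrite lerDl; apply: sumr_ge0.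
Qed.

(** A union bound over the coincidences of [collision], each bounded by [switching]: there are
    [#|W' :\: W|] choices of [u], 3 of [i], 4 of [j] and at most [#|W'| + 5] of [y]. *)
Lemma collision_bound W' : ord0 \in W -> W \subset W' ->
  (forall s, matching_family s -> h s != 0 ->
     clean s W /\ W' \subset closed_nbh (matching_graph s) W) ->
  (\sum_(s | matching_family s && ~~ clean s W') h s) * (n - (#|W|.*2 + 2))%:R
   <= (#|W' :\: W| * 12 * (#|W'| + 5))%:R * \sum_(s | matching_family s) h s.
Proof.
move=> W0 sub supp.
pose I := ('I_N * 'I_3 * option 'I_3 * 'I_N)%type.
pose P (c : I) := [&& c.1.1.1 \in W' :\: W, ~~ idle c.1.1.1, c.1.2 != Some c.1.1.2
  & c.2 \in W' :|: [set y | spoke y]].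
pose ev s (c : I) := (s c.1.1.2 c.1.1.1 \notin W) &&
  (s c.1.1.2 c.1.1.1 == target s c.1.2 c.2).
apply: (@le_trans _ _ (\sum_(c | P c)
    (\sum_(s | matching_family s && ev s c) h s) * (n - (#|W|.*2 + 2))%:R)).
  rewrite -mulr_suml ler_wpM2r //; under [leRHS]eq_bigr => c _ do rewrite big_mkcondr.
  rewrite exchange_big big_mkcondr /=; apply: ler_sum => s fs.
  have pos (c : I) : 0 <= if ev s c then h s else 0 by case: ifP.
  case: ifP => [ncl|_]; last exact: sumr_ge0.
  have [h0|/supp[//|cl cn]] := eqVneq (h s) 0; first by rewrite [leLHS]h0; apply: sumr_ge0.
  have [u [i [j [y [uW iu yW ji evs]]]]] := collision fs W0 cl sub cn ncl.
  have Pc : P (u, i, j, y) by rewrite /P /= uW iu ji.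
  have evc : ev s (u, i, j, y) by [].
  by rewrite (bigD1 _ Pc) /= evc lerDl; apply: sumr_ge0 => c _; apply: pos.
have each c : P c -> (\sum_(s | matching_family s && ev s c) h s)
    * (n - (#|W|.*2 + 2))%:R <= \sum_(s | matching_family s) h s.
  case: c => [[[u i] j] y] /and4P[/= /finset.setDP[_ uW] iu ji _].
  (* As [j != Some i], the target does not involve the [i]-th matching, the only one that a swap
     alters. *)
  apply: (@switching u i (fun s => target s j y)) => // s t z.
  by case: j ji => [j|] //= ji; rewrite ffunE; case: (j =P i) ji => // ->; rewrite eqxx.
apply: le_trans (ler_sum _ each) _.
rewrite sumr_const -[leLHS]mulr_natl; apply: ler_wpM2r; first exact: sumr_ge0.
rewrite ler_nat.
pose Q : {set I} := finset.setX
  (finset.setX (finset.setX (W' :\: W) [set: 'I_3]) [set: option 'I_3])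
  (W' :|: [set y | spoke y]).
apply: (@leq_trans #|Q|).
  apply: subset_leq_card; apply/fintype.subsetP => -[[[u i] j] y] /and4P[/= uW _ _ yW].
  by rewrite !finset.in_setX uW yW !inE.
rewrite !finset.cardsX !finset.cardsT card_option !card_ord; apply: leq_mul.
  by rewrite -mulnA.
by rewrite -[X in (_ + X)%N]card_spoke (leq_card_setU _ _).
Qed.
End Switching.
End MatchingGraph.

(** * The expected volume on a random instance *)

Section PotentialArgument.
Context (R : realType) (M : mender anchored_lcl R) (n : nat).
Hypothesis n_gt5 : (5 < n)%N.
Local Notation N := n.+1.
Implicit Types (s : matchings n) (W : {set 'I_N}).
Local Notation lam := (root_hole n).
Local Notation root := (ord0 : 'I_N).
Local Notation c s := (chain M (matching_graph s) lam root).
Local Notation it s := (chain_iter M (matching_graph s) lam root).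
Local Notation fam := (@matching_family n).

(** Locality applies because sparseness rules out a mend in [W] for both matchings; the labels are
    the same in both graphs. *)
Lemma chain_agree s s' W W' : fam s -> fam s' ->
  {in W, forall u i, s i u = s' i u} -> sparse s W -> c s' W W' = c s W W'.
Proof.
move=> fs fs' e sp; have sp' := sparse_agree fs fs' e sp.
have wid (le : (N <= N)%N) : widen_ord le =1 id by move=> x; apply: val_inj.
have widS (le : (N <= N)%N) (U : {set 'I_N}) : widen_ord le @: U = U.
  by rewrite (eq_imset _ (wid le)) imset_id.
have := @chain_locality _ _ M N N (leqnn N) (matching_graph s) lam root
  (matching_graph s') lam W W'.
rewrite /= !widS wid; apply.
- exact: root_hole_instance.
- exact: root_hole_instance.
- move=> u uW; rewrite wid widS; apply: matching_graph_agree => // i.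
  by rewrite e.
- by move=> u _; rewrite wid.
- exact: sparse_no_mend.
- exact: sparse_no_mend.
Qed.

(** By progress, only trajectories through subsets of [W'] contribute, and sparseness passes to
    subsets. *)
Lemma chain_iter_agree s s' W W' t : fam s -> fam s' ->
  {in W', forall u i, s i u = s' i u} -> sparse s W' -> W \subset W' ->
  it s' t W W' = it s t W W'.
Proof.
move=> fs fs' e sp; elim: t W => [|t IH] W sub //=.
apply: eq_bigr => U _; have [UW'|UW'] := boolP (U \subset W'); last first.
  by rewrite !(chain_iter_eq0 _ (root_hole_instance n_gt5 _)) ?mulr0.
rewrite IH // (chain_agree _ fs fs') //.
  by move=> u uW; apply: e; apply: (fintype.subsetP sub).
exact: sparseS sub sp.
Qed.

Variable k : nat.
Hypothesis k_small : (k.*2 + 2 < n)%N.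
(** The price of one newly explored vertex in [collision_bound], as long as fewer than [k] vertices
    are explored. *)
Let eps : R := (12 * (k + 5))%:R / (n - (k.*2 + 2))%:R.
Local Notation q s t W := (it s t [set root] W).

(* Averaged over the family this is a supermartingale along the chain; it
   dominates the indicator of having found a mend within fewer than [k]
   vertices. *)
Definition potential s W : R :=
  if (k <= #|W|)%N then 0 else (~~ clean s W)%:R + eps * (k - #|W|)%:R.

Lemma eps_ge0 : 0 <= eps. Proof. by rewrite divr_ge0. Qed.

Lemma potential_ge0 s W : 0 <= potential s W.
Proof. by rewrite /potential; case: ifP => // _; rewrite addr_ge0 ?mulr_ge0 ?eps_ge0. Qed.

(** The indicator is already at its maximum, and the remaining budget can only shrink. *)
Lemma potential_unclean s W W' : ~~ clean s W -> W \subset W' ->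
  potential s W' <= potential s W.
Proof.
move=> ncl /subset_leq_card sub; rewrite /potential ncl.
have [kW'|W'k] := leqP k #|W'|; last first.
  rewrite leqNgt (leq_ltn_trans sub W'k) /=; apply: lerD; first by case: (~~ _).
  by rewrite ler_wpM2l ?eps_ge0 // ler_nat leq_sub2l.
by case: ifP => // _; rewrite addr_ge0 ?mulr_ge0 ?eps_ge0.
Qed.

(** For clean [W], the weight [q s t W * c s W W'] depends on [s] only through the partners of
    vertices of [W], so [collision_bound] applies to it. The resulting loss of cleanness is paid for
    by the [eps] that each newly explored vertex takes from the budget. *)
Lemma clean_drift t W W' : root \in W -> (#|W| < k)%N ->
  \sum_(s | fam s && clean s W) q s t W * c s W W' * potential s W' <=
  \sum_(s | fam s && clean s W) q s t W * c s W W' * (eps * (k - #|W|)%:R).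
Proof.
move=> W0 Wk; have mi s (fs : fam s) := root_hole_instance n_gt5 fs.
have pos s : fam s -> 0 <= q s t W * c s W W'.
  by move=> fs; rewrite mulr_ge0 ?chain_iter_ge0 ?chain_ge0 ?mi.
have [kW'|W'k] := leqP k #|W'|.
  apply: ler_sum => s /andP[fs _]; rewrite /potential kW' mulr0.
  by rewrite mulr_ge0 ?pos // mulr_ge0 ?eps_ge0.
have [sub|nsub] := boolP (W \subset W'); last first.
  by apply: ler_sum => s /andP[fs _]; rewrite chain_eq0 ?mulr0 ?mul0r ?mi.
pose h s := if fam s && clean s W then q s t W * c s W W' else 0.
have h0 s : 0 <= h s by rewrite /h; case: ifP => // /andP[/pos].
have hagree s s' : fam s -> fam s' -> {in W, forall u i, s i u = s' i u} -> h s = h s'.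
  move=> fs fs' e; rewrite /h fs fs' /=.
  have -> : clean s W = clean s' W.
    apply/idP/idP; apply: clean_agree => // u uW i; exact/esym/e.
  case: ifP => // /andP[sp _]; have sp' : sparse s W.
    by apply: (sparse_agree fs' fs) sp => u uW i; apply/esym/e.
  congr (_ * _); apply/esym; last exact: chain_agree.
  by apply: chain_iter_agree => //; rewrite finset.sub1set.
have supp s : fam s -> h s != 0 -> clean s W /\ W' \subset closed_nbh (matching_graph s) W.
  move=> fs; rewrite /h fs /=; case: ifP => [cl hn0|]; last by rewrite eqxx.
  split=> //; apply: (@chain_exploration _ _ M _ _ _ _ _ _ (mi s fs) W0).
  rewrite lt_def chain_ge0 ?mi // andbT.
  by apply: contraNneq hn0 => ->; rewrite mulr0.
have bound := collision_bound n_gt5 h0 hagree W0 sub supp.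
have -> : \sum_(s | fam s && clean s W) q s t W * c s W W' * potential s W' =
    \sum_(s | fam s && ~~ clean s W') h s +
    eps * (k - #|W'|)%:R * \sum_(s | fam s) h s.
  rewrite big_mkcondr [X in _ = X + _]big_mkcondr mulr_sumr -big_split /=.
  apply: eq_bigr => s fs; rewrite /h fs /=; case: (clean s W); last first.
    by rewrite mulr0 addr0; case: ifP.
  rewrite /potential leqNgt W'k /= mulrDr; congr (_ + _); last by rewrite mulrC.
  by case: (clean s W'); rewrite /= ?mulr0 ?mulr1.
have -> : \sum_(s | fam s && clean s W) q s t W * c s W W' * (eps * (k - #|W|)%:R) =
    eps * (k - #|W|)%:R * \sum_(s | fam s) h s.
  rewrite -mulr_suml mulrC; congr (_ * _); rewrite big_mkcondr /=.
  by apply: eq_bigr => s fs; rewrite /h fs.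
set H := \sum_(s | fam s) h s in bound *; set B := \sum_(s | _) h s in bound *.
have H0 : 0 <= H by apply: sumr_ge0.
have B0 : 0 <= B by apply: sumr_ge0.
have dif : (k - #|W| = #|W' :\: W| + (k - #|W'|))%N.
  have := subset_leq_card sub; rewrite finset.cardsD (finset.setIidPr sub); lia.
rewrite dif natrD mulrDr mulrDl lerD2r.
rewrite /eps -mulrA [leRHS]mulrAC ler_pdivlMr ?ltr0n ?subn_gt0 //.
apply: (@le_trans _ _ (B * (n - (#|W|.*2 + 2))%:R)).
  by apply: ler_wpM2l => //; rewrite ler_nat; lia.
apply: le_trans bound _; rewrite mulrA -natrM; apply: ler_wpM2r => //.
by rewrite ler_nat -mulnA mulnC leq_mul // leq_mul //; lia.
Qed.

Definition mean_potential t : R := \sum_(s | fam s) \sum_W q s t W * potential s W.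

Lemma mean_potential_le t : mean_potential t.+1 <= mean_potential t.
Proof.
have mi s (fs : fam s) := root_hole_instance n_gt5 fs.
(* The sums are exchanged because for clean [W] the potential decreases only on average over [s] at
   a fixed transition. *)
have -> : mean_potential t.+1 =
    \sum_W \sum_(s | fam s) \sum_W' q s t W * c s W W' * potential s W'.
  rewrite /mean_potential [RHS]exchange_big; apply: eq_bigr => s fs.
  under [LHS]eq_bigr => W' _ do rewrite chain_iterSr mulr_suml.
  by rewrite exchange_big.
rewrite /mean_potential [leRHS]exchange_big; apply: ler_sum => W _.
have [W0|W0] := boolP (root \in W); last first.
  apply: ler_sum => s fs; rewrite chain_iter_eq0 ?mi ?finset.sub1set // mul0r.
  by rewrite big1 // => W' _; rewrite !mul0r.
have step s : fam s ->
    (forall W', W \subset W' -> potential s W' <= potential s W) ->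
    \sum_W' q s t W * c s W W' * potential s W' <= q s t W * potential s W.
  move=> fs le; under eq_bigr => W' _ do rewrite -mulrA.
  rewrite -mulr_sumr; apply: ler_wpM2l; first exact/chain_iter_ge0/mi.
  rewrite -[leRHS]mul1r -(chain_sum1 M W (mi s fs)) mulr_suml.
  apply: ler_sum => W' _; have [sub|nsub] := boolP (W \subset W').
    by apply: ler_wpM2l; [exact/chain_ge0/mi | exact: le].
  by rewrite chain_eq0 ?mi // !mul0r.
have [kW|Wk] := leqP k #|W|.
  apply: ler_sum => s fs; apply: step => // W' sub.
  by rewrite /potential (leq_trans kW (subset_leq_card sub)) kW.
rewrite [leLHS](bigID (fun s => clean s W)) [leRHS](bigID (fun s => clean s W)) /=.
apply: lerD; last first.
  by apply: ler_sum => s /andP[fs ncl]; apply: step => // W'; apply: potential_unclean.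
rewrite exchange_big; apply: (@le_trans _ _ (\sum_W' \sum_(s | fam s && clean s W)
    q s t W * c s W W' * (eps * (k - #|W|)%:R))).
  by apply: ler_sum => W' _; apply: clean_drift.
rewrite exchange_big; apply: ler_sum => s /andP[fs cl].
rewrite -mulr_suml -mulr_sumr chain_sum1 ?mi // mulr1.
by rewrite /potential leqNgt Wk /= cl add0r.
Qed.

End PotentialArgument.

Lemma matching_family_nonempty n : exists s : matchings n, matching_family s.
Proof.
(* Pairs 1 with 2, 3 with 4, and so on, fixing 0 and also [n] if [n] is odd. *)
pose g x := if x == 0%N then 0%N else
  if odd x then (if (x < n)%N then x.+1 else x) else x.-1.
have gn x : (x < n.+1)%N -> (g x < n.+1)%N.
  by move=> xn; rewrite /g; do 3?case: ifP => //; lia.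
exists [ffun=> [ffun x : 'I_n.+1 => inord (g x)]].
apply/forallP => i; apply/forallP => -[x xn]; rewrite !ffunE -!val_eqE /= !inordK ?gn //.
rewrite /idle -!val_eqE /= negbK {gn}/g.
case: x xn => [|x] xn /=; first by rewrite !eqxx.
have [ox|ox] /= := boolP (odd x).
  rewrite ifN; last by apply: contraTneq ox => ->.
  rewrite ox; have -> : (x < n)%N by [].
  rewrite eqxx (ltn_eqF (ltnSn x)) eq_sym eqbF_neg; apply/negP => /andP[on /eqP e].
  by rewrite -e /= ox in on.
have [xn'|xn'] /= := ltnP x.+1 n.
  rewrite ox eqxx (gtn_eqF (ltnSn x.+1)) eq_sym eqbF_neg; apply/negP => /andP[_ /eqP e].
  by rewrite e ltnn in xn'.
have e : x.+1 = n by apply/eqP; rewrite eqn_leq xn' andbT.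
by rewrite -e ltnn /= (negPf ox) /= !eqxx.
Qed.

Section HardInstance.
Context (R : realType) (M : mender anchored_lcl R).

Lemma expected_volume_large n k : (1 < k)%N -> (400 * k ^ 2 <= n.+1)%N ->
  exists2 s : matchings n, matching_family s &
    k%:R / 2 <= expected_volume M (matching_graph s) (root_hole n) ord0.
Proof.
move=> k1 kn.
have n5 : (5 < n)%N by nia.
have ksm : (k.*2 + 2 < n)%N by nia.
have mi s (fs : matching_family s) := root_hole_instance n5 fs.
pose small s (W : {set 'I_n.+1}) :=
  (chain M (matching_graph s) (root_hole n) ord0 W W == 1) && (#|W| < k)%N.
pose p s t := \sum_(W | small s W)
  chain_iter M (matching_graph s) (root_hole n) ord0 t [set ord0] W.
have pP s t : matching_family s -> p s t <=
    \sum_W chain_iter M (matching_graph s) (root_hole n) ord0 t [set ord0] W * potential R k s W.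
  move=> fs; rewrite [leRHS](bigID (small s)) /= -[leLHS]addr0; apply: lerD; last first.
    by apply: sumr_ge0 => W _; rewrite mulr_ge0 ?chain_iter_ge0 ?potential_ge0 ?mi.
  apply: ler_sum => W /andP[/eqP/(chain_termination M W (mi s fs)) cm Wk].
  rewrite -[leLHS]mulr1; apply: ler_wpM2l; first exact/chain_iter_ge0/mi.
  have ncl : ~~ clean s W.
    by apply: contraL cm => /andP[sp _]; apply: sparse_no_mend.
  by rewrite /potential leqNgt Wk /= ncl lerDl mulr_ge0 // divr_ge0.
(* The start is clean, so its potential is [eps * (k - 1)]; the constant 400 makes this at most
   1/2. *)
have mean0 : mean_potential M n k 0 <= \sum_(s : matchings n | matching_family s) 2^-1.
  apply: ler_sum => s fs; rewrite (bigD1 [set ord0]) //= eqxx mul1r big1 ?addr0; last first.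
    by move=> W ne; rewrite eq_sym (negPf ne) mul0r.
  rewrite /potential finset.cards1 leqNgt k1 /= clean_root //= add0r.
  rewrite mulrAC ler_pdivrMr ?ltr0n ?subn_gt0 // ler_pdivlMl // -!natrM ler_nat.
  nia.
have mean t : \sum_(s | matching_family s) p s t <= \sum_(s : matchings n | matching_family s) 2^-1.
  apply: le_trans mean0; apply: (@le_trans _ _ (mean_potential M n k t)).
    by apply: ler_sum => s fs; apply: pP.
  by elim: t => // t; apply/le_trans/mean_potential_le.
have [[s /andP[fs le]]|none] := pselect (exists s,
    matching_family s && (k%:R / 2 <= expected_volume M (matching_graph s) (root_hole n) ord0)).
  by exists s.
exfalso.
(* If the mass on small mends never exceeded 1/2 for some [s], then [expected_volume_ge] with
   [a = 1/2] would give the required bound. *)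
have late (s : matchings n) : exists t, matching_family s -> 2^-1 < p s t.
  have [fs|nfs] := boolP (matching_family s); last by exists 0%N.
  apply: contra_notP none => early; exists s; rewrite fs /=.
  have le t : p s t <= 2^-1 by rewrite leNgt; apply/negP => h; apply: early; exists t.
  have := expected_volume_ge (mi s fs) le.
  by congr (_ <= _); congr (_ * _); lra.
have [t ht] := choice late.
(* This mass is nondecreasing in time, so at the latest of the finitely many times it exceeds 1/2
   for all [s] at once, against the mean. *)
have := mean (\max_s t s)%N; apply/negP; rewrite -ltNge.
have [s0 fs0] := matching_family_nonempty n.
apply: ltr_sum => [|s fs]; first by apply/hasP; exists s0 => //; apply: mem_index_enum.
apply: lt_le_trans (ht s fs) _; rewrite /p; apply: (sum_chain_iter_mono (mi s fs)).
  by move=> W /andP[].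
exact: leq_bigmax.
Qed.

Lemma EMVol_large N k : (1 < k)%N -> (400 * k ^ 2 <= N)%N ->
  exists2 G : sgraph N, max_degree_le 5 G & k%:R / 2 <= EMVol M G.
Proof.
case: N => [|n] k1 kn; first by nia.
have [s fs le] := expected_volume_large k1 kn.
have n5 : (5 < n)%N by nia.
exists (matching_graph s); first exact: matching_graph_max_degree.
have /and3P[_ ps hole] := root_hole_instance n5 fs.
apply: le_trans (le_trans le _) (le_bigmax_cond _ _ ps).
exact: le_bigmax_cond.
Qed.

End HardInstance.

(** * Asymptotics *)

(** The logarithm of [x] is 4 times that of its fourth root, and [ln y <= y]. *)
Lemma ln_le_sqrt_sqrt (R : realType) (x : R) : 0 < x ->
  ln x <= 4 * Num.sqrt (Num.sqrt x).
Proof.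
move=> x0; have s0 : 0 < Num.sqrt (Num.sqrt x) by rewrite !sqrtr_gt0.
have {1}-> : x = Num.sqrt (Num.sqrt x) ^+ 4.
  by rewrite -[4%N]/(2 * 2)%N exprM !sqr_sqrtr ?sqrtr_ge0 // ltW.
rewrite lnXn // -[leLHS]mulr_natl.
by rewrite ler_pM2l //; apply: ltW; apply: ln_sublinear.
Qed.

Lemma exists_bounded_degree n : exists G : sgraph n, max_degree_le 5 G.
Proof.
have e : simple_nbh [ffun _ : 'I_n => finset.set0].
  by apply/forallP => u; rewrite !ffunE inE; apply/forallP => w; rewrite !ffunE !inE.
by exists (SGraph e); apply/forallP => u; rewrite ffunE finset.cards0.
Qed.

Local Open Scope classical_set_scope.
Local Open Scope ring_scope.

Lemma anchored_EMVol_omega (R : realType) :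
  has_EMVol_omega anchored_lcl (fun n : nat => ln (n%:R : R)).
Proof.
(* Dividing by 20 ensures [400 * k n ^ 2 <= n]. For the finitely many [n] with [k n <= 1] any graph
   of the class will do. *)
move=> M; pose k (n : nat) := Num.truncn (Num.sqrt (n%:R : R) / 20).
have hG n : exists G : sgraph n, max_degree_le 5 G /\
    ((1 < k n)%N -> (k n)%:R / 2 <= EMVol M G).
  have [k1|k1] := ltnP 1 (k n); last first.
    by have [G dG] := exists_bounded_degree n; exists G.
  have k2 : (400 * k n ^ 2 <= n)%N.
    rewrite -(ler_nat R) natrM natrX.
    have le : (k n)%:R <= Num.sqrt (n%:R : R) / 20.
      by rewrite truncn_le // divr_ge0 // sqrtr_ge0.
    rewrite -[leRHS](@sqr_sqrtr R) //.
    have := ler0n R (k n); nra.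
  by have [G dG le] := EMVol_large M k1 k2; exists G.
pose G n := sval (cid (hG n)); have hGn n := svalP (cid (hG n)).
exists G; split=> [n|]; first by have [] := hGn n.
apply/eqoP => eps eps0; near=> n.
set x := Num.sqrt (Num.sqrt (n%:R : R)).
(* With [10 <= x] one has [x ^+ 2 / 40 <= x ^+ 2 / 20 - 1], so [4 * x <= eps * k n / 2] follows from
   [320 <= eps * x]. *)
have xlarge : 10 + 320 / eps <= x.
  have e0 : 0 <= 10 + 320 / eps by rewrite addr_ge0 // divr_ge0 // ltW.
  rewrite -[leLHS]ger0_norm // -sqrtr_sqr ler_sqrt // -[leLHS]ger0_norm ?sqr_ge0 //.
  rewrite -sqrtr_sqr ler_sqrt //; near: n; exact: nbhs_infty_ger.
have d0 : 0 < 320 / eps by rewrite divr_gt0.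
have x2 : x ^+ 2 = Num.sqrt (n%:R : R) by rewrite sqr_sqrtr // sqrtr_ge0.
have xe : 320 <= eps * x by rewrite mulrC -ler_pdivrMr //; lra.
have kx : x ^+ 2 / 20 - 1 <= (k n)%:R.
  by rewrite x2 lerBlDr natr1; apply/ltW/truncnS_gt.
have k1 : (1 < k n)%N by rewrite -(ltr_nat R); apply: lt_le_trans kx; nra.
have [_ /(_ k1) le] := hGn n.
have n0 : (1 <= n%:R :> R).
  have -> : n%:R = (x ^+ 2) ^+ 2 :> R by rewrite x2 sqr_sqrtr.
  by rewrite -exprM exprn_ege1 //; lra.
rewrite ger0_norm ?ln_ge0 //.
apply: le_trans (ln_le_sqrt_sqrt (lt_le_trans ltr01 n0)) _; rewrite -/x.
apply: (@le_trans _ _ (eps * ((k n)%:R / 2))); last first.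
  by apply: ler_wpM2l; [exact: ltW | apply: le_trans le (ler_norm _)].
nra.
Unshelve. all: by end_near.
Qed.

Lemma anchored_MVol_bigO (R : realType) :
  (fun n : nat => (exists_MVol anchored_lcl n)%:R : R)
    =O_\oo (fun n : nat => ln (n%:R : R)).
Proof.
have l2 : 0 < ln (2 : R) by rewrite ln_gt0 // ltr1n.
(* The mending bound at exponent [m + 1] is [24 * m + 42], and both [m * ln 2] and [ln 2] are at
   most [ln n], whence 66 = 24 + 42. *)
apply/eqO_exP; exists (66 / ln 2); first by rewrite divr_gt0.
near=> n; have n2 : (1 < n)%N by near: n; exact: nbhs_infty_gt.
set m := trunc_log 2 n.
have /andP[mn nm] : (2 ^ m <= n < 2 ^ m.+1)%N by apply: trunc_log_bounds => //; lia.
have ln2 : ln 2 <= ln (n%:R : R) by rewrite ler_ln ?posrE ?ler_nat ?ltr0n //; lia.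
have lnm : m%:R * ln 2 <= ln (n%:R : R).
  rewrite mulr_natl -lnXn // -natrX ler_ln ?posrE ?ler_nat ?ltr0n ?expn_gt0 //; lia.
rewrite !ger0_norm ?ler0n ?(le_trans (ltW l2)) //.
apply: (@le_trans _ _ (24 * m%:R + 42)).
  by rewrite -natrM -natrD ler_nat; have := anchored_MVol_le nm; lia.
rewrite mulrAC ler_pdivlMr //; lra.
Unshelve. all: by end_near.
Qed.

Theorem mainTheorem8 (R : realType) :
  exists (P : lcl) (D : nat),
    [/\ forall n (G : sgraph n), lcl_class P G = max_degree_le D G,
        always_mendable P,
        (fun n : nat => (exists_MVol P n)%:R : R)
          =O_\oo (fun n : nat => ln (n%:R : R)) &
        has_EMVol_omega P (fun n : nat => ln (n%:R : R))].
Proof.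
exists anchored_lcl, 5%N; split=> //.
- exact: anchored_always_mendable.
- exact: anchored_MVol_bigO.
- exact: anchored_EMVol_omega.
Qed.
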